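(* For all positive integers $n$ and $k$, there is no generalized bent function $f:\mathbb{Z}_3^n\to\mathbb{Z}_{2^k}$.
   Context: A function $f:G\to\mathbb{Z}_m$ on a finite abelian group $G$ is a generalized bent function if $\left|\sum_{x\in G}\zeta_m^{f(x)}\chi(x)\right|^2=|G|$ for every character $\chi$ of $G$, where $\zeta_m$ is a primitive $m$-th root of unity. *)

(* Defs.v *)
From HB Require Import structures.
From mathcomp Require Export all_boot all_order all_algebra.
From mathcomp Require Export all_fingroup all_solvable all_field all_character.

Set Implicit Arguments.
Unset Strict Implicit.
Unset Printing Implicit Defensive.

Import GRing.Theory.
Local Open Scope ring_scope.

(* The characters of the abelian group G are its linear characters (the
   homomorphisms G -> C^*, with values in the algebraic numbers); MathComp's
   [character] also covers sums of these.
   'Z_m is the ring of integers mod m only for 1 < m.  The value f x : 'Z_m is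
   used as an exponent through its representative in {0, ..., m - 1}.
   zeta is meant to be a primitive m-th root of unity. *)
Definition generalized_bent (G : finZmodType) (m : nat) (zeta : algC)
    (f : G -> 'Z_m) : Prop :=
  forall chi : 'CF([set: G]%G), chi \is a linear_char ->
    `| \sum_(x : G) zeta ^+ f x * chi x | ^+ 2 = #|G|%:R.

(* Main.v *)
Require Import Defs.

(** Fourier inversion turns bentness into the vanishing of every nontrivial
    autocorrelation, [\sum_x zeta ^ (f (x + y) - f x) = 0] for [y != 0].  Such a
    sum has [3 ^ n] terms, all of them roots of unity of 2-power order; raising
    to the power [2 ^ k] is additive modulo 2, so the [2 ^ k]-th power of the sum
    is congruent to the odd integer [3 ^ n], and the sum cannot vanish. *)

Set Implicit Arguments.
Unset Strict Implicit.
Unset Printing Implicit Defensive.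

Import GRing.Theory Num.Theory.
Local Open Scope ring_scope.

(** The cross terms of the square are twice an algebraic integer. *)
Lemma eqAmod2_sqr_sum (I : Type) (r : seq I) (F : I -> algC) :
    (forall i, F i \in Aint) ->
  ((\sum_(i <- r) F i) ^+ 2 == \sum_(i <- r) F i ^+ 2 %[mod 2])%A.
Proof.
move=> AF; elim: r => [|i r IHr]; first by rewrite !big_nil expr0n eqAmod_refl.
have As : F i * \sum_(j <- r) F j \in Aint by rewrite rpredM ?rpred_sum.
rewrite !big_cons sqrrD -addrA [_ *+ 2 + _]addrC addrA -[X in eqAmod _ _ X]addr0.
apply: eqAmodD; first by rewrite eqAmodDl.
by rewrite -[_ * _ *+ 2]mulr_natr eqAmodMl0.
Qed.

Lemma eqAmod2_exp2n_sum (I : Type) (r : seq I) (F : I -> algC) k :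
    (forall i, F i \in Aint) ->
  ((\sum_(i <- r) F i) ^+ (2 ^ k) == \sum_(i <- r) F i ^+ (2 ^ k) %[mod 2])%A.
Proof.
move=> AF; elim: k => [|k IHk]; first by rewrite !expn0 expr1 eqAmod_refl.
have AFk i : F i ^+ (2 ^ k) \in Aint by rewrite rpredX.
rewrite expnSr exprM.
under [X in eqAmod _ _ X]eq_bigr do rewrite exprM.
apply: eqAmod_trans (eqAmod2_sqr_sum r AFk).
by rewrite !expr2 eqAmodM ?rpred_sum // rpredX ?rpred_sum.
Qed.

Lemma sum_exp2n_unity_neq0 (I : finType) (F : I -> algC) k :
  odd #|I| -> (forall i, F i ^+ (2 ^ k) = 1) -> \sum_i F i != 0.
Proof.
move=> oddI F1; have k2_gt0 : (0 < 2 ^ k)%N by rewrite expn_gt0.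
have AF i : F i \in Aint.
  by apply: (Aint_unity_root k2_gt0); apply/unity_rootP.
apply: contraL oddI => /eqP sF0.
have := eqAmod2_exp2n_sum (index_enum I) k AF.
rewrite sF0 expr0n gtn_eqF // (eq_bigr _ (fun i _ => F1 i)) sumr_const.
(* A natural number divisible by 2 among the algebraic integers is even, so [#|I|] would be even. *)
by rewrite eqAmod_sym (eqAmod0_nat 2) dvdn2.
Qed.

(** The squared moduli of the character sums of [u], weighted by the conjugate of ['chi_i y] and
    summed over [i], are evaluated in two ways. *)
Lemma generalized_bent_autocorr (G : finZmodType) m zeta (f : G -> 'Z_m) y :
    generalized_bent zeta f -> y != 0 ->
  \sum_x zeta ^+ f (x + y) * (zeta ^+ f x)^* = 0.
Proof.
move=> bent_f nz_y; pose u x := zeta ^+ f x.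
have abG : abelian [set: G] := FinRing.zmod_abelian _.
have lin_chi i : 'chi[[set: G]%G]_i \is a linear_char by apply/char_abelianP.
(* In an abelian group centralizers are everything and conjugacy classes are singletons. *)
have orthoG x z :
  \sum_i 'chi[[set: G]%G]_i x * ('chi_i z)^* = #|G|%:R *+ (x == z).
- rewrite second_orthogonality_relation ?inE //.
  have -> : 'C_[set: G][x]%g = [set: G].
    by apply/setIidPl/(subset_trans abG); rewrite -cent_set1 centS ?subsetT.
  rewrite cardsT; congr (_ *+ nat_of_bool _).
  have -> : (z ^: [set: G])%g = [set z].
    apply/setP=> t; rewrite in_set1; apply/imsetP/eqP=> [[s _ ->]|->].
      by rewrite conjgE !FinRing.zmodMgE FinRing.zmodVgE addrC addrK.
    by exists 1%g; rewrite ?inE ?conjg1.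
  by rewrite inE.
have nzG : #|G|%:R != 0 :> algC.
  by rewrite pnatr_eq0 -lt0n; apply/card_gt0P; exists 0.
apply: (mulfI nzG); rewrite mulr0.
transitivity (\sum_i (\sum_x u x * 'chi[[set: G]%G]_i x)
    * (\sum_z u z * 'chi_i z)^* * ('chi_i y)^*); last first.
  (* Bentness makes every squared modulus [#|G|]; the factor ['chi_i 0], equal to 1, puts the rest
     in the form of [orthoG]. *)
  transitivity (#|G|%:R * \sum_i 'chi[[set: G]%G]_i 0 * ('chi_i y)^*).
    rewrite mulr_sumr; apply: eq_bigr => i _.
    by rewrite -normCK bent_f // (lin_char1 (lin_chi i)) mul1r.
  by rewrite orthoG eq_sym (negPf nz_y) mulr0.
(* Summing over [i] first leaves only [x = z + y], which gives [#|G|] times the autocorrelation. *)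
transitivity (\sum_x \sum_z \sum_i u x * (u z)^*
    * ('chi[[set: G]%G]_i x * ('chi_i (z + y))^*)).
  rewrite exchange_big mulr_sumr; apply: eq_bigr => z _.
  under eq_bigr do rewrite -mulr_sumr orthoG.
  rewrite (bigD1 (z + y)) //= big1 ?addr0 => [|x /negPf->]; last by rewrite mulr0.
  by rewrite eqxx mulrC.
rewrite exchange_big; under eq_bigr do rewrite exchange_big.
rewrite exchange_big; apply: eq_bigr => i _.
rewrite exchange_big !mulr_suml; apply: eq_bigr => x _.
rewrite rmorph_sum mulr_sumr mulr_suml; apply: eq_bigr => z _.
by rewrite (lin_charM (lin_chi i)) ?inE // !rmorphM /= !mulrA [_ * _ * (u z)^*]mulrAC.
Qed.

Theorem no_generalized_bent_odd (G : finZmodType) k zeta (f : G -> 'Z_(2 ^ k)) :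
    (2 ^ k)%N.-primitive_root zeta -> odd #|G| -> (1 < #|G|)%N ->
  ~ generalized_bent zeta f.
Proof.
move=> zeta_prim oddG /card_gt1P[a [b [_ _ neq_ab]]] bent_f.
have nz_y : b - a != 0 by rewrite subr_eq0 eq_sym.
have /eqP := generalized_bent_autocorr bent_f nz_y.
apply/negP/(@sum_exp2n_unity_neq0 _ _ k) => // x.
(* Both factors of a term are killed by the exponent [2 ^ k], the order of [zeta]. *)
by rewrite exprMn -rmorphXn /= -!exprM ![(_ * 2 ^ k)%N]mulnC !exprM
           (prim_expr_order zeta_prim) !expr1n rmorph1 mulr1.
Qed.

Theorem theorem4p1 (n k : nat) (zeta : algC)
    (n_gt0 : (0 < n)%N) (k_gt0 : (0 < k)%N)
    (zeta_prim : (2 ^ k)%N.-primitive_root zeta) :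
  ~ exists f : 'rV['Z_3]_n -> 'Z_(2 ^ k), generalized_bent zeta f.
Proof.
have cardG : #|{: 'rV['Z_3]_n}| = (3 ^ n)%N by rewrite card_mx card_ord mul1n.
case=> f; apply: no_generalized_bent_odd => //; rewrite cardG.
  by rewrite oddX orbT.
by rewrite -(expn0 3) ltn_exp2l.
Qed.
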